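(* Let $(X,\tau_X,\mathfrak{a})$ and $(Y,\tau_Y,\mathfrak{b})$ be aura topological spaces. If both $\mathfrak{a}$ and $\mathfrak{b}$ are transitive, then $$\tau_{\mathfrak{a}\times\mathfrak{b}}=\tau_{\mathfrak{a}}\times\tau_{\mathfrak{b}}.$$ Moreover, $\mathfrak{a}\times\mathfrak{b}$ is transitive.
   Context: An aura topological space $(X,\tau,\mathfrak{a})$ is a topological space $(X,\tau)$ together with a function $\mathfrak{a}:X\to\tau$ (a scope function) such that $x\in\mathfrak{a}(x)$ for every $x\in X$. The scope function is transitive if $y\in\mathfrak{a}(x)$ implies $\mathfrak{a}(y)\subseteq\mathfrak{a}(x)$ for all $x,y\in X$. A subset $A\subseteq X$ is $\mathfrak{a}$-open if $\mathfrak{a}(x)\subseteq A$ for every $x\in A$; the collection $\tau_{\mathfrak{a}}$ of all $\mathfrak{a}$-open sets is a topology on $X$ with $\tau_{\mathfrak{a}}\subseteq\tau$. For topologies $\sigma$ on $X$ and $\rho$ on $Y$, $\sigma\times\rho$ denotes the product topology on $X\times Y$. The product aura space of $(X,\tau_X,\mathfrak{a})$ and $(Y,\tau_Y,\mathfrak{b})$ is $(X\times Y,\tau_X\times\tau_Y,\mathfrak{a}\times\mathfrak{b})$, where $(\mathfrak{a}\times\mathfrak{b})(x,y)=\mathfrak{a}(x)\times\mathfrak{b}(y)$; thus $\tau_{\mathfrak{a}\times\mathfrak{b}}$ consists of all $W\subseteq X\times Y$ with $\mathfrak{a}(x)\times\mathfrak{b}(y)\subseteq W$ for every $(x,y)\in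 W$. *)

(* Defs.v *)
From HB Require Import structures.
From mathcomp Require Import all_boot all_classical topology.

Set Implicit Arguments.
Unset Strict Implicit.
Unset Printing Implicit Defensive.

Local Open Scope classical_set_scope.

Record aura (X : topologicalType) := Aura {
  scope :> X -> set X;
  scope_open : forall x, open (scope x);
  scope_refl : forall x, scope x x }.

Definition aura_transitive (X : topologicalType) (a : aura X) : Prop :=
  forall x y, a x y -> a y `<=` a x.

Definition aura_open (X : topologicalType) (a : aura X) (A : set X) : Prop :=
  forall x, A x -> a x `<=` A.

(* An alias of X carrying the topology of a-open sets instead of that of X. *)
Definition aura_topology (X : topologicalType) (a : aura X) : Type := X.

Section AuraTopology.
Variables (X : topologicalType) (a : aura X).

Lemma aura_openT : aura_open a setT.
Proof. by []. Qed.

Lemma aura_openI (A B : set X) :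
  aura_open a A -> aura_open a B -> aura_open a (A `&` B).
Proof.
by move=> oA oB x [Ax Bx] y axy; split; [exact: (oA x) | exact: (oB x)].
Qed.

Lemma aura_open_bigU (I : Type) (f : I -> set X) :
  (forall i, aura_open a (f i)) -> aura_open a (\bigcup_i f i).
Proof. by move=> of_ x [i _ fix_] y axy; exists i => //; exact: (of_ i x). Qed.

HB.instance Definition _ := Choice.on (aura_topology a).
HB.instance Definition _ := isOpenTopological.Build (aura_topology a)
  aura_openT aura_openI aura_open_bigU.

Lemma aura_topology_openE : @open (aura_topology a) = aura_open a.
Proof. by []. Qed.

Lemma aura_open_open (A : set X) : aura_open a A -> open A.
Proof.
move=> oA; rewrite openE => x Ax; apply: (filterS (oA x Ax)).
by apply: open_nbhs_nbhs; split; [exact: scope_open | exact: scope_refl].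
Qed.

End AuraTopology.

Section ProductAura.
Variables (X Y : topologicalType) (a : aura X) (b : aura Y).

Definition prod_scope (p : X * Y) : set (X * Y) := a p.1 `*` b p.2.

Lemma prod_scope_open p : open (prod_scope p).
Proof.
rewrite openE => -[x y] [/= ax bx]; exists (a p.1, b p.2) => //=.
by split; apply: open_nbhs_nbhs; split => //; exact: scope_open.
Qed.

Lemma prod_scope_refl p : prod_scope p p.
Proof. by split; exact: scope_refl. Qed.

Definition prod_aura : aura (X * Y)%type :=
  Aura prod_scope_open prod_scope_refl.

End ProductAura.

(* Main.v *)
(** When [a] is transitive, each [a x] is itself a-open, hence the least
    neighbourhood of [x] in the topology of a-open sets; so [a x `*` b y] is the
    least neighbourhood of [(x, y)] in the product topology. *)
Require Import Defs.
From mathcomp Require Import all_boot all_classical topology.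

Local Open Scope classical_set_scope.

Lemma aura_nbhsP (X : topologicalType) (a : aura X) (x : X) (A : set X) :
  aura_transitive a -> @nbhs _ (aura_topology a) x A <-> a x `<=` A.
Proof.
move=> ta; rewrite nbhsE /=; split=> [[U [oU Ux] UA]|axA].
  by apply: subset_trans UA; exact: oU.
(* Transitivity is what makes [a x] a-open, so it is its own open witness. *)
exists (a x) => //; split; last exact: scope_refl.
by move=> y; exact: ta.
Qed.

Lemma prod_aura_transitive (X Y : topologicalType) (a : aura X) (b : aura Y) :
  aura_transitive a -> aura_transitive b -> aura_transitive (prod_aura a b).
Proof.
move=> ta tb p q [aq bq] r [ar br].
by split; [exact: (ta _ _ aq) | exact: (tb _ _ bq)].
Qed.

Theorem theorem5p10 (X Y : topologicalType) (a : aura X) (b : aura Y) :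
  aura_transitive a -> aura_transitive b ->
  aura_open (prod_aura a b) = @open (aura_topology a * aura_topology b)%type
  /\ aura_transitive (prod_aura a b).
Proof.
move=> ta tb; split; last exact: prod_aura_transitive.
apply/funext => W; apply/propext; rewrite openE; split=> oW [x y] Wxy.
  (* The least product neighbourhood of [(x, y)]; [oW] at this point puts it inside [W]. *)
  exists (a x, b y); last exact: (oW (x, y)).
  by split; apply/aura_nbhsP.
(* Conversely, some rectangle with sides [A] and [B] around [(x, y)] lies in [W]; its sides contain
   [a x] and [b y], so [W] contains the scope of [(x, y)]. *)
have [[A B] [/= /(aura_nbhsP _ _ _ _ ta) aA /(aura_nbhsP _ _ _ _ tb) bB] ABW] :=
  oW _ Wxy.
by apply: subset_trans ABW => -[u v] [/aA ? /bB ?].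
Qed.
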